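(* Let $(g,m,m)$ be the data of an isometric cohomogeneity one action on a sphere with equal multiplicities $m=m_0=m_1$. The spectral problem $$\xi''(x)-(m-1)\tanh(x)\,\xi'(x)-m\tanh^2(x)\,\xi(x)+\Big(\lambda+m-2\frac{m}{g}\Big)\frac{\xi(x)}{\cosh^2(x)}=0,\qquad x\in\mathbb{R},$$ describing the equivariant stability of the linear solution $r(t)=(1-g)t$, parametrized by $r(x)=(1-g)\frac2g\arctan(e^x)$, is solved by $$\xi_j(x)=\frac{1}{\cosh(x)}\,C^{\left(\frac{m+2}{2}\right)}_{j-1}\big(\tanh(x)\big),\qquad \lambda_j=j(j+m)+2\frac{m}{g}-2m,$$ where $j\in\{1,2,3,\dots\}$.
   Context: Data: for an isometric cohomogeneity one action on the round sphere $\mathbb{S}^{n+1}$, $g$ is the number of distinct principal curvatures of the principal orbits; here all multiplicities equal $m$, so $n=gm$; $g,m$ are positive integers. Origin of the problem: equivariant self-maps $a\cdot\gamma(t)\mapsto a\cdot\gamma(r(t))$ along a unit speed normal geodesic $\gamma$, $t\in[0,\pi/g]$, have (with $m_0=m_1=m$) Jacobi equation $$\ddot\xi+\tfrac{gm\cos(gt)}{\sin(gt)}\dot\xi-\tfrac{gm}{\sin^2(gt)}\Big[(g-2)\cos(2(r(t)-t))+2\cos(2(r(t)-t)+gt)\cos(gt)\Big]\xi+\lambda\xi=0.$$ For the harmonic self-map with $r(t)=(1-g)t$ the change of variables $t=\frac2g\arctan(e^x)$, with $\lambda$ rescaled by the factor $g^2$, gives the spectral problem of the claim. $C_k^{(\delta)}$,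 $k\ge0$, denotes the Gegenbauer polynomial of degree $k$, a polynomial solution of $(1-y^2)f''(y)-(2\delta+1)yf'(y)+k(k+2\delta)f(y)=0$, given by $C_0^{(\delta)}=1$, $C_1^{(\delta)}(y)=2\delta y$ and $C_k^{(\delta)}(y)=\frac1k\big(2y(k+\delta-1)C_{k-1}^{(\delta)}(y)-(k+2\delta-2)C_{k-2}^{(\delta)}(y)\big)$ for $k\ge2$. *)

(* Defs.v *)
From mathcomp Require Export all_boot all_order all_algebra.
From mathcomp Require Export all_classical all_reals all_analysis.

Set Implicit Arguments.
Unset Strict Implicit.
Unset Printing Implicit Defensive.

Export Order.TTheory GRing.Theory Num.Theory numFieldNormedType.Exports.
Global Open Scope classical_set_scope.
Global Open Scope ring_scope.

(* Isometries of the unit sphere S^(n+1) in R^(n+2) are the restrictions of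
   orthogonal matrices, and an isometric action of a compact Lie group has the
   same orbits as its image, a closed subgroup of O(n+2). *)
Definition dotv (R : realType) (N : nat) (u v : 'cV[R]_N) : R :=
  (u^T *m v) 0 0.

Definition on_sphere (R : realType) (N : nat) (p : 'cV[R]_N) : Prop :=
  dotv p p = 1.

Definition closed_orthogonal_subgroup (R : realType) (N : nat)
    (G : set 'M[R]_N.+1) : Prop :=
  [/\ closed G,
      G 1%:M,
      forall A B, G A -> G B -> G (A *m B),
      forall A, G A -> G (invmx A)
    & forall A, G A -> A^T *m A = 1%:M].

(* For a closed subgroup G this is its full Lie algebra, even though the
   curves are only required to be differentiable at 0. *)
Definition lie_algebra (R : realType) (N : nat) (G : set 'M[R]_N.+1) :
    set 'M[R]_N.+1 :=
  [set A | exists c : R -> 'M[R]_N.+1,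
    [/\ forall s, G (c s), c 0 = 1%:M & is_derive (0 : R) (1 : R) c A]].

Definition orbit_tangent (R : realType) (N : nat) (G : set 'M[R]_N.+1)
    (p : 'cV[R]_N.+1) : set 'cV[R]_N.+1 :=
  [set A *m p | A in lie_algebra G].

(* The orbit of p is principal: up to conjugation, the isotropy group of p is
   contained in every isotropy group. *)
Definition principal_point (R : realType) (N : nat) (G : set 'M[R]_N.+1)
    (p : 'cV[R]_N.+1) : Prop :=
  on_sphere p /\
  forall q, on_sphere q -> exists2 A, G A &
    forall B, G B -> B *m p = p -> (A *m B *m invmx A) *m q = q.

Definition has_dim (R : realType) (N : nat) (S : set 'cV[R]_N) (k : nat) :
    Prop :=
  exists2 U : {vspace 'cV[R]_N}, (forall v, v \in U <-> S v) & \dim U = k.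

Definition cohomogeneity_one (R : realType) (n : nat)
    (G : set 'M[R]_n.+2) : Prop :=
  closed_orthogonal_subgroup G /\
  forall p, principal_point G p -> has_dim (orbit_tangent G p) n.

Definition unit_normal (R : realType) (N : nat) (G : set 'M[R]_N.+1)
    (p nu : 'cV[R]_N.+1) : Prop :=
  [/\ dotv nu nu = 1, dotv nu p = 0
    & forall v, orbit_tangent G p v -> dotv nu v = 0].

(* On a principal orbit of codimension one, nu extends to the unit normal field
   a p |-> a nu.  Hence the shape operator v |-> - D_v nu maps v = A p to
   - A nu, for A in the Lie algebra (- A nu is already tangent to the orbit). *)
Definition shape_operator (R : realType) (N : nat) (G : set 'M[R]_N.+1)
    (p nu v w : 'cV[R]_N.+1) : Prop :=
  exists2 A, lie_algebra G A & v = A *m p /\ w = - (A *m nu).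

Definition curvature_space (R : realType) (N : nat) (G : set 'M[R]_N.+1)
    (p nu : 'cV[R]_N.+1) (kappa : R) : set 'cV[R]_N.+1 :=
  [set v | shape_operator G p nu v (kappa *: v)].

Definition principal_curvature (R : realType) (N : nat) (G : set 'M[R]_N.+1)
    (p nu : 'cV[R]_N.+1) (kappa : R) : Prop :=
  exists2 v, v != 0 & curvature_space G p nu kappa v.

(* (g, m, m) is the data of the action: the principal orbits have exactly g
   distinct principal curvatures, all of multiplicity m. *)
Definition equal_multiplicity_data (R : realType) (n : nat)
    (G : set 'M[R]_n.+2) (g m : nat) : Prop :=
  [/\ (0 < g)%N, (0 < m)%N, cohomogeneity_one G
    & forall p nu, principal_point G p -> unit_normal G p nu ->
      exists kappa : 'I_g -> R,
        [/\ injective kappa,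
            forall k, principal_curvature G p nu k <-> range kappa k
          & forall i, has_dim (curvature_space G p nu (kappa i)) m]].

Definition cosh (R : realType) (x : R) : R := (expR x + expR (- x)) / 2.
Definition sinh (R : realType) (x : R) : R := (expR x - expR (- x)) / 2.
Definition tanh (R : realType) (x : R) : R := sinh x / cosh x.

Definition twice_derivable_on (R : realType) (D : set R) (f : R -> R) : Prop :=
  forall x, D x -> derivable f x 1 /\ derivable (derive1 f) x 1.

Definition solves_jacobi (R : realType) (g m : nat) (r : R -> R) (lam : R)
    (xi : R -> R) : Prop :=
  let I := [set t : R | 0 < t < pi / g%:R] in
  twice_derivable_on I xi /\
  forall t, I t ->
    derive1 (derive1 xi) t
    + (g%:R * m%:R * cos (g%:R * t) / sin (g%:R * t)) * derive1 xi t
    - g%:R * m%:R / sin (g%:R * t) ^+ 2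
      * ((g%:R - 2) * cos (2 * (r t - t))
         + 2 * cos (2 * (r t - t) + g%:R * t) * cos (g%:R * t)) * xi t
    + lam * xi t = 0.

Definition linear_solution (R : realType) (g : nat) (t : R) : R :=
  (1 - g%:R) * t.

Definition geodesic_parameter (R : realType) (g : nat) (x : R) : R :=
  2 / g%:R * atan (expR x).

Definition solves_spectral_ode (R : realType) (g m : nat) (lam : R)
    (xi : R -> R) : Prop :=
  twice_derivable_on setT xi /\
  forall x,
    derive1 (derive1 xi) x
    - (m%:R - 1) * tanh x * derive1 xi x
    - m%:R * tanh x ^+ 2 * xi x
    + (lam + m%:R - 2 * (m%:R / g%:R)) * (xi x / cosh x ^+ 2) = 0.

Definition spectral_solution (R : realType) (g m : nat) (lam : R)
    (xi : R -> R) : Prop :=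
  solves_spectral_ode g m lam xi /\ exists x, xi x != 0.

Fixpoint gegenbauer (R : realType) (delta : R) (k : nat) : {poly R} :=
  match k with
  | 0 => 1
  | k1.+1 =>
    match k1 with
    | 0 => (2 * delta) *: 'X
    | k2.+1 =>
      (k%:R)^-1 *: ((2 * (k%:R + delta - 1)) *: ('X * gegenbauer delta k1)
                    - (k%:R + 2 * delta - 2) *: gegenbauer delta k2)
    end
  end.

Definition xi_ (R : realType) (m j : nat) (x : R) : R :=
  1 / cosh x * (gegenbauer ((m%:R + 2) / 2) j.-1).[tanh x].

Definition lambda_ (R : realType) (g m j : nat) : R :=
  j%:R * (j%:R + m%:R) + 2 * (m%:R / g%:R) - 2 * m%:R.
Arguments lambda_ : clear implicits.

(* Main.v *)
(** With [y = tanh x] one has [y' = 1 - y^2 = 1 / cosh^2 x], so the ansatz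
    [xi = p(y) / cosh x] turns the spectral ODE, up to the factor
    [(1 - y^2) / cosh x], into the Gegenbauer equation for [delta = (m+2)/2] and
    [k = j-1]; the constants match since [k (k + 2 delta) = j (j+m) - m - 1].
    The Gegenbauer equation follows from the two first order relations
    [k C_k = y C_k' - C_(k-1)'] and [C_k' = y C_(k-1)' + (k-1+2 delta) C_(k-1)],
    which the recurrence propagates simultaneously.

    For the change of variables [t = tau(x) = (2/g) arctan(e^x)] one has
    [sin(g t) = 1 / cosh x], [cos(g t) = - tanh x] and [tau' = 1 / (g cosh x)],
    so the Jacobi operator is [(g cosh x)^2] times the spectral one; regularity is
    carried back along the inverse [t |-> ln(tan(g t / 2))]. *)
Require Import Defs.
From mathcomp Require Import ring.

Set Implicit Arguments.
Unset Strict Implicit.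
Unset Printing Implicit Defensive.

(** * Gegenbauer polynomials: differential equation and nonvanishing *)

Section GegenbauerIdentities.
Variables (R : realType) (delta : R).
Local Notation C := (gegenbauer delta).

Lemma gegenbauer_rec k :
  k.+2%:R *: C k.+2 =
  (2 * (k.+1%:R + delta)) *: ('X * C k.+1) - (k%:R + 2 * delta) *: C k.
Proof.
rewrite [C k.+2]/= scalerA mulfV ?pnatr_eq0// scale1r.
by congr (_ *: _ - _ *: _); rewrite -?[k.+2%:R]natr1 -?[k.+1%:R]natr1; ring.
Qed.

Lemma gegenbauer_deriv k :
  k.+1%:R *: C k.+1 = 'X * (C k.+1)^`() - (C k)^`() /\
  (C k.+1)^`() = 'X * (C k)^`() + (k%:R + 2 * delta) *: C k.
Proof.
elim: k => [|k [IH1 IH2]].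
  rewrite /= derivZ derivX -polyC1 derivC -!mul_polyC.
  by rewrite !(polyCM, polyCD) !rmorph_nat; split; ring.
have rec := gegenbauer_rec k.
have step : (C k.+2)^`() = 'X * (C k.+1)^`() + (k.+1%:R + 2 * delta) *: C k.+1.
  (* The recurrence divides by [k+2]; it is differentiated with that factor cleared, and the nonzero
     constant is cancelled in the polynomial ring. *)
  have k2 : k.+2%:R != 0 :> {poly R} by rewrite -polyC_natr polyC_eq0 pnatr_eq0.
  apply: (mulfI k2).
  have := congr1 (@deriv R) rec; rewrite !(derivB, derivZ, derivM, derivX).
  move: IH1; rewrite -!mul_polyC !(polyCM, polyCD) !rmorph_nat => IH1 ->.
  have -> : (C k)^`() = 'X * (C k.+1)^`() - k.+1%:R * C k.+1.
    by rewrite IH1; ring.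
  ring.
split=> //; rewrite rec step.
move: IH1 IH2; rewrite -!mul_polyC !(polyCM, polyCD) !rmorph_nat => IH1 IH2.
(* The second relation at [k] eliminates [C k], then the first eliminates its derivative, so that
   only [C k.+1] and its derivative remain. *)
have -> : (k%:R + 2 * delta%:P) * C k = (C k.+1)^`() - 'X * (C k)^`().
  by rewrite IH2; ring.
have -> : (C k)^`() = 'X * (C k.+1)^`() - k.+1%:R * C k.+1.
  by rewrite IH1; ring.
ring.
Qed.

Lemma gegenbauer_ode k (y : R) :
  (1 - y ^+ 2) * (C k)^`()^`().[y] - (2 * delta + 1) * y * (C k)^`().[y]
  + k%:R * (k%:R + 2 * delta) * (C k).[y] = 0.
Proof.
case: k => [|k]; first by rewrite /= -polyC1 !derivC !hornerC; ring.
have [I II] := gegenbauer_deriv k.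
have I' := congr1 (@deriv R) I; have II' := congr1 (@deriv R) II.
move: (congr1 (horner^~ y) I) (congr1 (horner^~ y) II).
move: (congr1 (horner^~ y) I') (congr1 (horner^~ y) II').
rewrite !(derivD, derivN, derivZ, derivM, derivX) !hornerE.
rewrite -natr1.
set a : R := _^`()^`().[y]; set b := (C k)^`()^`().[y].
set a' := (C k.+1)^`().[y]; set b' := (C k)^`().[y] => e1 e2 e3 e4.
(* The derivatives [b'] and [b] of [C k] are expressed through [C k.+1] by the first relation and
   its derivative. The differentiated second relation then yields [(1 - y^2) a] in terms of [a'],
   [b'] and [y]. *)
have eb' : b' = y * a' - (k%:R + 1) * (C k.+1).[y] by rewrite e3; ring.
have eb : b = a' + y * a - (k%:R + 1) * a' by rewrite e1; ring.
have ea : (1 - y ^+ 2) * a =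
    b' + y * (a' - (k%:R + 1) * a') + (k%:R + 2 * delta) * b'.
  by rewrite mulrBl mul1r {1}e2 eb; ring.
rewrite ea eb'; ring.
Qed.

(** At [y = 1] the three-term recurrence collapses to two terms, since
    [2(k+1+delta) - (k+1) = k+1+2 delta]. This makes the values at 1 positive for positive [delta],
    so the polynomials do not vanish identically. *)
Lemma gegenbauer_horner1 k :
  k.+1%:R * (C k.+1).[1] = (k%:R + 2 * delta) * (C k).[1].
Proof.
elim: k => [|k IH]; first by rewrite /= !hornerE; ring.
have := congr1 (horner^~ 1) (gegenbauer_rec k).
rewrite hornerD hornerN !hornerZ hornerM hornerX => ->.
by rewrite -IH -[k.+1%:R]natr1; ring.
Qed.

Lemma gegenbauer_neq0 k : 0 < delta -> C k != 0.
Proof.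
move=> d0; suff : 0 < (C k).[1].
  by apply: contraTneq => ->; rewrite horner0 ltxx.
elim: k => [|k IH]; first by rewrite hornerE.
rewrite -(pmulr_rgt0 _ (ltr0Sn R k)) gegenbauer_horner1 mulr_gt0//.
by rewrite ltr_wpDl// mulr_gt0.
Qed.

End GegenbauerIdentities.

(** * Hyperbolic functions and polynomials in [tanh] *)

Section Hyperbolic.
Variable R : realType.
Implicit Types x y : R.

Lemma is_derive1_derive1 (f : R -> R) x df :
  is_derive x 1 f df -> derive1 f x = df.
Proof. by move=> ?; rewrite derive1E derive_val. Qed.

Lemma is_derive1_derivable (f : R -> R) x df :
  is_derive x 1 f df -> derivable f x 1.
Proof. by case. Qed.

Lemma cosh_gt0 x : 0 < cosh x.
Proof. by rewrite divr_gt0// addr_gt0 ?expR_gt0. Qed.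

Lemma cosh2Bsinh2 x : cosh x ^+ 2 - sinh x ^+ 2 = 1.
Proof.
have e : expR x * expR (- x) = 1 by rewrite -expRD subrr expR0.
by rewrite /cosh /sinh -[RHS]e; field.
Qed.

Lemma tanh2 x : tanh x ^+ 2 = 1 - (cosh x)^-1 ^+ 2.
Proof.
have c0 : cosh x != 0 by rewrite gt_eqF ?cosh_gt0.
have e : sinh x ^+ 2 = cosh x ^+ 2 - 1 by rewrite -(cosh2Bsinh2 x); ring.
by rewrite /tanh expr_div_n e; field.
Qed.

Lemma is_derive_expRN x : is_derive x 1 (fun y => expR (- y)) (- expR (- x)).
Proof.
have := is_derive1_comp (is_derive_expR (- x)) (is_deriveNid x (1 : R)).
by move=> h; apply: is_derive_eq; rewrite mulrN1.
Qed.

Lemma is_derive_cosh x : is_derive x 1 (@cosh R) (sinh x).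
Proof.
have h := is_deriveM (is_deriveD (is_derive_expR x) (is_derive_expRN x))
  (is_derive_cst (2^-1 : R) x 1).
by apply: (is_derive_eq h); rewrite scaler0 add0r /GRing.scale/= mulrC.
Qed.

Lemma is_derive_sinh x : is_derive x 1 (@sinh R) (cosh x).
Proof.
have h := is_deriveM (is_deriveB (is_derive_expR x) (is_derive_expRN x))
  (is_derive_cst (2^-1 : R) x 1).
by apply: (is_derive_eq h); rewrite scaler0 add0r opprK /GRing.scale/= mulrC.
Qed.

Lemma is_derive_sech x :
  is_derive x 1 (fun y => (cosh y)^-1) (- tanh x * (cosh x)^-1).
Proof.
have c0 : cosh x != 0 by rewrite gt_eqF ?cosh_gt0.
apply: (is_derive_eq (is_deriveV c0 (is_derive_cosh x))).
by rewrite /tanh /GRing.scale/=; field.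
Qed.

Lemma is_derive_tanh x : is_derive x 1 (@tanh R) ((cosh x)^-1 ^+ 2).
Proof.
have c0 : cosh x != 0 by rewrite gt_eqF ?cosh_gt0.
apply: (is_derive_eq (is_deriveM (is_derive_sinh x) (is_derive_sech x))).
have e : sinh x ^+ 2 = cosh x ^+ 2 - 1 by rewrite -(cosh2Bsinh2 x); ring.
rewrite /tanh /GRing.scale/=.
have -> : sinh x * (- (sinh x / cosh x) / cosh x) + (cosh x)^-1 * cosh x =
   1 - sinh x ^+ 2 / cosh x ^+ 2 by field.
by rewrite e; field.
Qed.

Lemma tanh_inj : injective (@tanh R).
Proof.
move=> x y /eqP; rewrite /tanh eqr_div;
  [move=> /eqP h|by rewrite gt_eqF ?cosh_gt0..].
have e : expR x * expR (- x) = 1 by rewrite -expRD subrr expR0.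
have e' : expR y * expR (- y) = 1 by rewrite -expRD subrr expR0.
apply: expR_inj; apply/eqP.
rewrite -(@eqrXn2 _ 2%N) ?expR_ge0//; apply/eqP.
(* The cross-multiplied equality says [sinh (x-y) = 0], that is [e^(x-y) = e^(y-x)]; this gives
   [e^(2x) = e^(2y)]. *)
have h2 : expR x * expR (- y) = expR (- x) * expR y.
  apply/eqP; rewrite -subr_eq0; apply/eqP.
  have -> : expR x * expR (- y) - expR (- x) * expR y =
      2 * (sinh x * cosh y - sinh y * cosh x) by rewrite /cosh /sinh; field.
  by rewrite h subrr mulr0.
rewrite -[LHS]mulr1 -e' -[RHS]mulr1 -e.
have -> : expR x ^+ 2 * (expR y * expR (- y)) =
    (expR x * expR y) * (expR x * expR (- y)) by ring.
by rewrite h2; ring.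
Qed.

(** By injectivity, [tanh] takes [size p] distinct values at [0, ..., size p - 1], one more than the
    degree of [p] allows as roots. *)
Lemma horner_tanh_neq0 (p : {poly R}) : p != 0 -> exists x, p.[tanh x] != 0.
Proof.
move=> p0; apply: contrapT => /forallNP h.
pose rs := [seq tanh (i%:R : R) | i <- iota 0 (size p)].
have rts : all (root p) rs.
  by apply/allP => _ /mapP[i _ ->]; apply: contrapT => /negP/h.
have urs : uniq rs.
  rewrite map_inj_uniq ?iota_uniq// => i j /tanh_inj/eqP.
  by rewrite eqr_nat => /eqP.
by have := max_poly_roots p0 rts urs; rewrite size_map size_iota ltnn.
Qed.

(** Functions of the form [p(tanh) / cosh] are closed under differentiation, which acts on [p] as
    the operator [p |-> (1 - X^2) p' - X p]. Second derivatives come from applying it twice. *)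
Lemma is_derive_sech_horner (p : {poly R}) x :
  is_derive x 1 (fun y => (cosh y)^-1 * p.[tanh y])
    ((cosh x)^-1 * ((1 - 'X^2) * p^`() - 'X * p).[tanh x]).
Proof.
have h := is_deriveM (is_derive_sech x)
  (is_derive1_comp (is_derive_poly p (tanh x)) (is_derive_tanh x)).
apply: (is_derive_eq h); rewrite !hornerE /GRing.scale/= tanh2; ring.
Qed.

End Hyperbolic.

(** * The explicit solutions of the spectral problem *)

Section SpectralSolution.
Variables (R : realType).

Lemma sech_horner_derive1 (p : {poly R}) :
  derive1 (fun y => (cosh y)^-1 * p.[tanh y]) =
  fun y => (cosh y)^-1 * ((1 - 'X^2) * p^`() - 'X * p).[tanh y].
Proof.
by apply/funext => x; apply/is_derive1_derive1/is_derive_sech_horner.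
Qed.

Lemma spectral_solution_gegenbauer g m k :
  spectral_solution g m (lambda_ R g m k.+1) (xi_ m k.+1).
Proof.
set delta : R := (m%:R + 2) / 2; set p := gegenbauer delta k.
have xiE : xi_ m k.+1 = fun x : R => (cosh x)^-1 * p.[tanh x].
  by apply/funext => x; rewrite /xi_ div1r.
split; last first.
  have p0 : p != 0 by apply: gegenbauer_neq0; rewrite divr_gt0// ltr_wpDl.
  have [x px] := horner_tanh_neq0 p0.
  by exists x; rewrite xiE mulf_neq0// invr_neq0// gt_eqF ?cosh_gt0.
rewrite /solves_spectral_ode xiE; split=> [x _|x]; rewrite !sech_horner_derive1.
  by split; exact/is_derive1_derivable/is_derive_sech_horner.
rewrite -[(_ / cosh x ^+ 2)]/((cosh x)^-1 * p.[tanh x] * (cosh x ^+ 2)^-1).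
rewrite -exprVn.
have -> : (cosh x)^-1 ^+ 2 = 1 - tanh x ^+ 2 by rewrite tanh2; ring.
have ode := gegenbauer_ode delta k (tanh x).
rewrite -/p in ode; set y := tanh x in ode *; set s := (cosh x)^-1.
have hornerL (q r : {poly R}) :
    ((1 - 'X^2) * q - 'X * r).[y] = (1 - y ^+ 2) * q.[y] - y * r.[y].
  by rewrite hornerD hornerN !hornerM hornerD hornerN hornerC hornerXn hornerX.
have -> : ((1 - 'X^2) * p^`() - 'X * p)^`() =
    ((1 - 'X^2) * p^`()^`() - 'X * (3%:R *: p^`())) - p.
  rewrite derivB !derivM derivB derivX derivXn -polyC1 derivC -mul_polyC.
  by rewrite rmorph_nat; ring.
rewrite hornerL hornerL hornerD hornerN hornerL hornerZ /lambda_.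
(* With [1 / cosh^2 = 1 - y^2], every term is a polynomial in [y] times [s], and the factor
   [1 - y^2] splits off, leaving the Gegenbauer equation. *)
transitivity (s * (1 - y ^+ 2) * ((1 - y ^+ 2) * p^`()^`().[y]
  - (2 * delta + 1) * y * p^`().[y] + k%:R * (k%:R + 2 * delta) * p.[y])).
  have -> : 2 * delta = m%:R + 2 by rewrite /delta; field.
  by rewrite -natr1; ring.
by rewrite ode mulr0.
Qed.

End SpectralSolution.

(** * The change of variables between the geodesic interval and the real line *)

Section GeodesicParameter.
Variables (R : realType) (g : nat).
Hypothesis g0 : (0 < g)%N.
Implicit Types (x t : R).
Local Notation tau := (geodesic_parameter g).

Let gR : (g%:R : R) != 0. Proof. by rewrite pnatr_eq0 -lt0n. Qed.
Let gp : 0 < (g%:R : R). Proof. by rewrite ltr0n. Qed.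

Definition geodesic_parameter_inv t : R := ln (tan (g%:R * t / 2)).
Local Notation sigma := geodesic_parameter_inv.

Lemma geodesic_parameter_angle x : g%:R * tau x = atan (expR x) *+ 2.
Proof. by rewrite /geodesic_parameter -mulr_natl; field. Qed.

Lemma geodesic_parameter_itv x : 0 < tau x < pi / g%:R.
Proof.
apply/andP; split.
  by rewrite mulr_gt0 ?divr_gt0// -(atan0 R) lt_atan ?expR_gt0.
rewrite ltr_pdivlMr// mulrC geodesic_parameter_angle -mulr_natr -ltr_pdivlMr//.
exact: atan_ltpi2.
Qed.

Lemma cos2_atan x : cos (atan x) ^+ 2 = (1 + x ^+ 2)^-1.
Proof. by rewrite cos_atan exprVn sqr_sqrtr// addr_ge0 ?sqr_ge0. Qed.

Lemma sin_geodesic_parameter x : sin (g%:R * tau x) = (cosh x)^-1.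
Proof.
have c0 : cos (atan (expR x)) != 0.
  by rewrite -sqrf_eq0 cos2_atan invr_eq0 gt_eqF// ltr_wpDr ?sqr_ge0.
rewrite geodesic_parameter_angle sin_mulr2n.
(* With [theta = atan e], [sin (2 theta) = 2 tan theta cos^2 theta = 2e / (1 + e^2)]; only the
   square of the cosine enters, so no square root appears. *)
have -> : sin (atan (expR x)) = expR x * cos (atan (expR x)).
  by rewrite -{2}(atanK (expR x)) /tan divfK.
rewrite mulrCA -expr2 cos2_atan /cosh expRN.
have := expR_gt0 x; set e := expR x => e0.
have e1 : e != 0 by rewrite gt_eqF.
have e2 : 1 + e ^+ 2 != 0 by rewrite gt_eqF// ltr_wpDr ?sqr_ge0.
by field; rewrite ?e1 ?e2 // addrC e2.
Qed.

Lemma cos_geodesic_parameter x : cos (g%:R * tau x) = - tanh x.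
Proof.
rewrite geodesic_parameter_angle cos_mulr2n cos2_atan /tanh /sinh /cosh expRN.
have := expR_gt0 x; set e := expR x => e0.
have e1 : e != 0 by rewrite gt_eqF.
have e2 : 1 + e ^+ 2 != 0 by rewrite gt_eqF// ltr_wpDr ?sqr_ge0.
by field; rewrite ?e1 ?e2 // addrC e2.
Qed.

Lemma is_derive_geodesic_parameter x :
  is_derive x 1 tau (g%:R * cosh x)^-1.
Proof.
have h := is_deriveZ (2 / g%:R)
  (is_derive1_comp (is_derive1_atan (expR x)) (is_derive_expR x)).
apply: (is_derive_eq h); rewrite /GRing.scale /= /cosh expRN.
have := expR_gt0 x; set e := expR x => e0.
have e1 : e != 0 by rewrite gt_eqF.
have e2 : 1 + e ^+ 2 != 0 by rewrite gt_eqF// ltr_wpDr ?sqr_ge0.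
by field; rewrite ?e1 ?e2 ?gR // addrC e2.
Qed.

Lemma half_angle_itv t : 0 < t < pi / g%:R -> 0 < g%:R * t / 2 < pi / 2.
Proof.
move=> /andP[t0 tpi]; rewrite divr_gt0 ?mulr_gt0//= ltr_pM2r// mulrC.
by rewrite -ltr_pdivlMr.
Qed.

Lemma tan_half_angle_gt0 t : 0 < t < pi / g%:R ->
  0 < cos (g%:R * t / 2) /\ 0 < tan (g%:R * t / 2).
Proof.
move=> /half_angle_itv /andP[a0 api].
have c : 0 < cos (g%:R * t / 2).
  by rewrite cos_gt0_pihalf// api (lt_trans _ a0)// oppr_lt0 divr_gt0 ?pi_gt0.
by split=> //; rewrite divr_gt0// sin_gt0_pihalf// a0.
Qed.

Lemma geodesic_parameter_invK t : 0 < t < pi / g%:R -> tau (sigma t) = t.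
Proof.
move=> It; have [_ tan0] := tan_half_angle_gt0 It.
have /andP[a0 api] := half_angle_itv It.
rewrite /geodesic_parameter /sigma lnK ?posrE// tanK; first by field.
by rewrite in_itv/= api (lt_trans _ a0)// oppr_lt0 divr_gt0 ?pi_gt0.
Qed.

Lemma derivable_geodesic_parameter_inv t :
  0 < t < pi / g%:R -> derivable sigma t 1.
Proof.
move=> It; have [c0 tan0] := tan_half_angle_gt0 It.
pose a (u : R) : R := g%:R * u / 2.
have h : is_derive t 1 a (g%:R / 2).
  apply: (is_derive_eq (is_deriveM
    (is_deriveZ (g%:R : R) (is_derive_id t (1 : R)))
    (is_derive_cst (2^-1 : R) t 1))).
  by rewrite scaler0 add0r /GRing.scale/= mulr1 mulrC.
have c1 : cos (g%:R * t / 2) != 0 by rewrite gt_eqF.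
have ht : is_derive t 1 (@tan R \o a) _ :=
  @is_derive1_comp _ tan a t _ _ (is_derive_tan c1) h.
have hl : is_derive t 1 (@ln R \o (@tan R \o a)) _ :=
  @is_derive1_comp _ (@ln R) (@tan R \o a) t _ _ (is_derive1_ln tan0) ht.
by case: hl.
Qed.

Local Notation itv := [set t : R | 0 < t < pi / g%:R].

Lemma near_geodesic_itv t : 0 < t < pi / g%:R -> \near t, 0 < t < pi / g%:R.
Proof.
move=> It; have It' : t \in `]0, pi / g%:R[ by rewrite in_itv.
by near=> u; have : u \in `]0, pi / g%:R[ by near: u; exact: near_in_itvoo.
Unshelve. all: by end_near.
Qed.

Lemma is_derive_comp_geodesic_parameter (f : R -> R) x :
  derivable f (tau x) 1 ->
  is_derive x 1 (f \o tau) (derive1 f (tau x) * (g%:R * cosh x)^-1).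
Proof.
move=> /derivableP df; rewrite derive1E.
exact: is_derive1_comp df (is_derive_geodesic_parameter x).
Qed.

(** Since [tau] and [sigma] compose to the identity on the open interval, [f] agrees near [t] with
    [(f \o tau) \o sigma], and the chain rule applies there. *)
Lemma derivable_of_geodesic_parameter (f : R -> R) t : itv t ->
  derivable (f \o tau) (sigma t) 1 -> derivable f t 1.
Proof.
move=> It /derivableP df.
have /derivableP ds := derivable_geodesic_parameter_inv It.
apply: (@near_eq_derivable _ _ _ ((f \o tau) \o sigma)).
  near=> u; rewrite /= geodesic_parameter_invK//.
  by near: u; exact: near_geodesic_itv.
by case: (is_derive1_comp df ds).
Unshelve. all: by end_near.
Qed.

(** * Transfer of regularity and of the equation along [tau] *)

Section Transfer.
Variable f : R -> R.
Local Notation F := (f \o tau).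

Lemma derive1_comp_geodesic_parameter x : derivable f (tau x) 1 ->
  derive1 F x = derive1 f (tau x) * (g%:R * cosh x)^-1.
Proof.
by move=> df; apply/is_derive1_derive1/is_derive_comp_geodesic_parameter.
Qed.

Lemma is_derive_derive1_comp_geodesic_parameter x : twice_derivable_on itv f ->
  is_derive x 1 (derive1 F)
    ((derive1 (derive1 f) (tau x) / g%:R * (cosh x)^-1
      - tanh x * derive1 f (tau x)) / (g%:R * cosh x)).
Proof.
move=> hf.
have -> : derive1 F = fun x => (derive1 f \o tau) x * (g%:R^-1 * (cosh x)^-1).
  apply/funext => y; rewrite derive1_comp_geodesic_parameter ?invfM//.
  by have [] := hf _ (geodesic_parameter_itv y).
have [_ ddf] := hf _ (geodesic_parameter_itv x).
have h := is_deriveM (is_derive_comp_geodesic_parameter ddf)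
  (is_deriveZ (g%:R^-1 : R) (is_derive_sech x)).
apply: (is_derive_eq h); rewrite /GRing.scale/= /GRing.scale/=.
have c0 : cosh x != 0 by rewrite gt_eqF ?cosh_gt0.
by field; rewrite gR c0.
Qed.

Lemma twice_derivable_geodesic_parameter :
  twice_derivable_on itv f <-> twice_derivable_on setT F.
Proof.
split=> [hf x _|hF].
  have [df _] := hf _ (geodesic_parameter_itv x).
  split; apply: is_derive1_derivable.
    exact: is_derive_comp_geodesic_parameter.
  exact: is_derive_derive1_comp_geodesic_parameter.
have df t : itv t -> derivable f t 1.
  move=> It; apply: derivable_of_geodesic_parameter => //.
  by case: (hF (sigma t)).
move=> t It; split; first exact: df.
apply: derivable_of_geodesic_parameter => //.
(* Solving the chain rule for [f'] shows that [f' \o tau] is [F'] times a smooth factor, so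
   derivability of [F'] passes to [f']. *)
have -> : derive1 f \o tau = fun x => derive1 F x * (g%:R * cosh x).
  apply/funext => x; rewrite derive1_comp_geodesic_parameter.
    by rewrite divfK// mulf_neq0// gt_eqF ?cosh_gt0.
  exact/df/geodesic_parameter_itv.
have [_ /derivableP ddF] := hF (sigma t) I.
by case: (is_deriveM ddF (is_deriveZ (g%:R : R) (is_derive_cosh (sigma t)))).
Qed.

Lemma jacobi_spectral m lam x : twice_derivable_on itv f ->
  let t := tau x in
  derive1 (derive1 f) t
    + (g%:R * m%:R * cos (g%:R * t) / sin (g%:R * t)) * derive1 f t
    - g%:R * m%:R / sin (g%:R * t) ^+ 2
      * ((g%:R - 2) * cos (2 * (linear_solution g t - t))
         + 2 * cos (2 * (linear_solution g t - t) + g%:R * t) * cos (g%:R * t))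
      * f t
    + g%:R ^+ 2 * lam * f t =
  (g%:R * cosh x) ^+ 2 *
  (derive1 (derive1 F) x
    - (m%:R - 1) * tanh x * derive1 F x
    - m%:R * tanh x ^+ 2 * F x
    + (lam + m%:R - 2 * (m%:R / g%:R)) * (F x / cosh x ^+ 2)).
Proof.
move=> hf t; have [df _] := hf _ (geodesic_parameter_itv x).
rewrite (is_derive1_derive1 (is_derive_derive1_comp_geodesic_parameter x hf)).
rewrite (derive1_comp_geodesic_parameter df) -/t /=.
(* For [r(t) = (1-g)t] one has [r(t) - t = -g t]. The longer expression is rewritten first because
   it contains the other one. *)
have -> : 2 * (linear_solution g t - t) + g%:R * t = - (g%:R * t).
  by rewrite /linear_solution; ring.
have -> : 2 * (linear_solution g t - t) = - ((g%:R * t) *+ 2).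
  by rewrite /linear_solution; ring.
rewrite !cosN cos_mulr2n sin_geodesic_parameter cos_geodesic_parameter -/t.
have c0 : cosh x != 0 by rewrite gt_eqF ?cosh_gt0.
(* The bracket is split into [tanh^2] and [1 / cosh^2] parts. Times [m / g], they give the potential
   [m tanh^2] and the shift [m - 2m/g] of the eigenvalue. *)
have -> : (g%:R - 2) * ((- tanh x) ^+ 2 *+ 2 - 1) + 2 * - tanh x * - tanh x =
    g%:R * tanh x ^+ 2 - (g%:R - 2) * (cosh x)^-1 ^+ 2.
  have -> : (cosh x)^-1 ^+ 2 = 1 - tanh x ^+ 2 by rewrite tanh2; ring.
  ring.
by field; rewrite gR c0.
Qed.

End Transfer.

End GeodesicParameter.

(** * Equivalence of the two problems and their explicit solutions *)

Theorem proposition4p4 (R : realType) (n g m : nat) (G : set 'M[R]_n.+2)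
    (hG : equal_multiplicity_data G g m) :
  (* the spectral problem describes the equivariant stability of r(t) = (1-g)t *)
  (forall (lam : R) (xi : R -> R),
     solves_jacobi g m (linear_solution g) (g%:R ^+ 2 * lam) xi <->
     solves_spectral_ode g m lam (fun x => xi (geodesic_parameter g x))) /\
  (* and it is solved by xi_j, lambda_j *)
  (forall j : nat, (1 <= j)%N ->
     spectral_solution g m (lambda_ R g m j) (xi_ m j)).
Proof.
have [g0 _ _ _] := hG.
split=> [lam xi|[//|k] _]; last exact: spectral_solution_gegenbauer.
rewrite /solves_jacobi /solves_spectral_ode.
split=> -[h ode]; split; first exact/(twice_derivable_geodesic_parameter g0).
- move=> x; move: (ode _ (geodesic_parameter_itv g0 x)).
  rewrite (jacobi_spectral g0 m lam x h) => /eqP.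
  (* The conformal factor relating the two operators never vanishes, so it can be cancelled. *)
  have gc0 : (g%:R * cosh x) ^+ 2 != 0.
    by rewrite expf_neq0// mulf_neq0 ?pnatr_eq0 -?lt0n// gt_eqF ?cosh_gt0.
  by rewrite mulf_eq0 (negbTE gc0) => /eqP.
- exact/(twice_derivable_geodesic_parameter g0).
- move=> t It; have h' := (twice_derivable_geodesic_parameter g0 xi).2 h.
  (* Each [t] in the interval is [tau x] with [x = ln (tan (g t / 2))], so the spectral equation at
     this [x] gives the Jacobi equation at [t]. *)
  rewrite -(geodesic_parameter_invK g0 It) (jacobi_spectral g0 m lam _ h').
  by rewrite [X in _ * X]ode mulr0.
Qed.
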